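(* Let $T$ be a tree with burning number $b(T)=m$. Suppose that for every optimal burning sequence $(x_1,\dots,x_m)$ of $T$ the following two conditions hold: (1) the associated neighbourhoods $N_{m-1}[x_1],N_{m-2}[x_2],\dots,N_0[x_m]$ are mutually non-overlapping (pairwise disjoint); (2) every leaf of $T$ is burned in the last round, i.e. $\min_{1\le i\le m}\bigl(i+d(u,x_i)\bigr)=m$ for every leaf $u$ of $T$. Then $T$ is maximally $m$-burnable.
   Context: All graphs are finite, simple, undirected. $d(u,v)$ is the distance in the graph and $N_k[v]=\{u: d(u,v)\le k\}$. A sequence $(x_1,\dots,x_m)$ of vertices of a graph $G$ is a burning sequence of $G$ if $N_{m-1}[x_1]\cup N_{m-2}[x_2]\cup\cdots\cup N_0[x_m]=V(G)$ and $d(x_i,x_j)\ge j-i$ for all $i<j$ (this models choosing $x_i$ as a new fire source in round $i$, fire spreading to all neighbours of burned vertices each round; the vertex $u$ becomes burned in round $\min_i(i+d(u,x_i))$). The burning number $b(G)$ is the least length of a burning sequence; $G$ is $m$-burnable if $b(G)\le m$; a burning sequence of length $b(G)$ is optimal. $N_{m-i}[x_i]$ is the neighbourhood associated to $x_i$. In a tree, a leaf is a vertex of degree one, a branch vertex is a vertex of degree at least three, an arm is a path from a branch vertex to a leaf with no branch vertex in between, and an internal path is a path between two branch vertices with no other branch vertex in between. A tree $T$ with $b(T)=m$ is maximally $m$-burnable if every tree obtained from $T$ by inserting one new vertex into one of its arms or internal paths (i.e. subdividing one edge of an arm or internal path) is not $m$-burnable. *)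

(* Defs.v *)
From mathcomp Require Import all_boot.
Set Implicit Arguments.
Unset Strict Implicit.
Unset Printing Implicit Defensive.

Section Graphs.
Variables (V : finType) (e : rel V).

Definition simple_graph : Prop := symmetric e /\ irreflexive e.

Definition connected : Prop := 0 < #|V| /\ forall u v, connect e u v.

Definition acyclic : Prop := forall c : seq V, 2 < size c -> ~ ucycle e c.

Definition is_tree : Prop := [/\ simple_graph, connected & acyclic].

Definition degree (v : V) : nat := #|[set u | e v u]|.

Definition leaf (v : V) : bool := degree v == 1.

Definition branch (v : V) : bool := 2 < degree v.

(* If there is no walk from u to v, the value is #|V|, which exceeds every
   actual distance.  As a burning sequence has at most #|V| terms, this stands
   for an infinite distance in all the definitions below. *)
Definition dist (u v : V) : nat :=
  find (fun k => [exists p : k.-tuple V, path e u p && (last u p == v)])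
       (iota 0 #|V|).

Definition ball (k : nat) (v : V) : {set V} := [set u | dist v u <= k].

(* Positions are counted from 0: tnth x i is the source x_(i+1), lit in round
   i.+1. *)
Definition assoc_nbhd (m : nat) (x : m.-tuple V) (i : 'I_m) : {set V} :=
  ball (m - i.+1) (tnth x i).

Definition spread_out (m : nat) (x : m.-tuple V) : bool :=
  [forall i : 'I_m, forall j : 'I_m,
     (i < j) ==> (j - i <= dist (tnth x i) (tnth x j))].

Definition burning_seq (m : nat) (x : m.-tuple V) : bool :=
  (\bigcup_(i < m) assoc_nbhd x i == [set: V]) && spread_out x.

(* For 0 < m the default m + #|V| bounds every term, so this is the minimum. *)
Definition burn_round (m : nat) (x : m.-tuple V) (u : V) : nat :=
  \big[minn/m + #|V|]_(i < m) (i.+1 + dist u (tnth x i)).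

Definition has_burning_seq (m : nat) : bool :=
  [exists x : m.-tuple V, burning_seq x].

Lemma dist0 (v : V) : dist v v = 0.
Proof.
rewrite /dist; have: 0 < #|V| by apply/card_gt0P; exists v.
case: #|V| => //= n _.
by case: existsP => // H; case: H; exists [tuple]; rewrite /= eqxx.
Qed.

Lemma spread_out_leq (m : nat) (x : m.-tuple V) : spread_out x -> m <= #|V|.
Proof.
move/forallP => sx; rewrite -[leqLHS]card_ord -(@card_codom _ _ (tnth x)).
  exact: max_card.
suff H (i j : 'I_m) : i < j -> tnth x i <> tnth x j.
  move=> i j eqx; apply/val_inj => /=.
  by case: (ltngtP i j) => // /H; rewrite eqx.
move=> ltij eqx; have /forallP/(_ j) := sx i.
by rewrite ltij eqx dist0 leqn0 subn_eq0 leqNgt ltij.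
Qed.

Lemma ex_burning_seq : exists m, has_burning_seq m.
Proof.
pose P m := [exists x : m.-tuple V, spread_out x].
have exP : exists m, P m.
  exists 0; apply/existsP; exists [tuple]; apply/forallP; by case.
have ubP m : P m -> m <= #|V| by case/existsP => x /spread_out_leq.
case: (ex_maxnP exP ubP) => m /existsP[x sx] maxm.
exists m; apply/existsP; exists x; rewrite /burning_seq sx andbT.
apply/eqP/setP => v; rewrite in_setT; apply/idP/negPn/negP => vNx.
suff /maxm : P m.+1 by rewrite ltnn.
apply/existsP; exists [tuple of rcons x v].
apply/forallP => i; apply/forallP => j; apply/implyP => ltij.
have ltim : i < m by exact: leq_trans ltij (ltn_ord j).
rewrite !(tnth_nth v) /= !nth_rcons size_tuple ltim.
case: (ltnP j m) => [ltjm | lemj].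
  move/forallP/(_ (Ordinal ltim))/forallP/(_ (Ordinal ltjm)): sx => /=.
  by rewrite ltij !(tnth_nth v).
have -> : j = m :> nat by apply/eqP; rewrite eqn_leq lemj -ltnS ltn_ord.
rewrite eqxx; have: v \notin assoc_nbhd x (Ordinal ltim).
  by apply: contra vNx => vx; apply/bigcupP; exists (Ordinal ltim).
by rewrite inE -ltnNge (tnth_nth v) /= subnSK.
Qed.

Definition burning_number : nat := ex_minn ex_burning_seq.

Definition burnable (m : nat) : Prop := burning_number <= m.

(* The path has vertices x :: p; its inner vertices are behead (belast x p). *)
Definition simple_path (x : V) (p : seq V) : bool := path e x p && uniq (x :: p).

Definition no_branch_between (x : V) (p : seq V) : bool :=
  ~~ has branch (behead (belast x p)).

Definition arm (x : V) (p : seq V) : bool :=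
  [&& simple_path x p, branch x, leaf (last x p) & no_branch_between x p].

Definition internal_path (x : V) (p : seq V) : bool :=
  [&& simple_path x p, x != last x p, branch x, branch (last x p)
    & no_branch_between x p].

(* None is the new vertex. *)
Definition subdivide (u v : V) : rel (option V) := fun a b =>
  match a, b with
  | Some a, Some b =>
      e a b && ~~ (((a == u) && (b == v)) || ((a == v) && (b == u)))
  | Some a, None => (a == u) || (a == v)
  | None, Some b => (b == u) || (b == v)
  | None, None => false
  end.

End Graphs.

(* zip (x :: p) p lists the consecutive pairs of x :: p. *)
Definition maximally_burnable (V : finType) (e : rel V) (m : nat) : Prop :=
  [/\ is_tree e, burning_number e = m &
      forall (x : V) (p : seq V) (u v : V),
        arm e x p \/ internal_path e x p ->
        (u, v) \in zip (x :: p) p ->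
        ~ burnable (subdivide e u v) m].

(* Main.v *)
(* Suppose the tree T' obtained by inserting w into the edge uv of T is covered
   by balls of radii m - 1, ..., 0, and contract w to u or v.  The images of the
   centres give a cover of T, and under condition (1) every such cover is a
   burning sequence.  The ball containing w, of radius r say, reaches one step
   further in T than in T' across the contracted edge.  So on that side either
   some vertex at distance exactly r from its centre lies in a second ball,
   against (1), or all the vertices it reaches, a leaf among them, are at
   distance less than r, against (2). *)
Require Import Defs.
From mathcomp Require Import all_boot zify.
Set Implicit Arguments.
Unset Strict Implicit.
Unset Printing Implicit Defensive.

(** * Distances and geodesics *)

Section Distance.
Variables (V : finType) (e : rel V).
Implicit Types (u v w : V) (p : seq V).

Lemma dist_path u p : path e u p -> dist e u (last u p) <= size p.
Proof.
move=> up; case: (ltnP (size p) #|V|) => [ltp|]; last first.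
  (* [dist] never exceeds its default [#|V|], which settles walks of length at least [#|V|]. *)
  by apply: leq_trans; rewrite -[leqRHS](size_iota 0) /dist find_size.
rewrite leqNgt; apply/negP => /(before_find 0)/= /negbT/negP; apply.
rewrite nth_iota // add0n; apply/existsP; exists (in_tuple p).
by rewrite /= up eqxx.
Qed.

Lemma dist_lt_path u v :
  dist e u v < #|V| ->
  exists2 p, path e u p & last u p = v /\ size p = dist e u v.
Proof.
move=> ltd; have := ltd; rewrite /dist -{2}(size_iota 0 #|V|) -has_find.
move/(nth_find 0) => /=; rewrite -/(dist e u v) nth_iota // add0n.
by case/existsP => p /andP[up /eqP lp]; exists p => //; rewrite size_tuple.
Qed.

Lemma path_crossing (P : pred V) u p :
    path e u p -> ~~ P u -> P (last u p) ->
  exists a b, [/\ e a b, ~~ P a, P b & b \in p].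
Proof.
elim: p u => [|b p IHp] u /=; first by move=> _ /negPf->.
case/andP => eub bp nPu Pl; case Pb: (P b).
  by exists u, b; rewrite mem_head.
have [||a [c [eac nPa Pc cp]]] := IHp b bp => //; first by rewrite Pb.
by exists a, c; rewrite in_cons cp orbT.
Qed.

Hypotheses (sym_e : symmetric e) (conn : connected e).

Lemma dist_lt u v : dist e u v < #|V|.
Proof.
have [p up ->] := connectP (conn.2 u v); case/shortenP: up => q uq Uq _.
apply: leq_ltn_trans (dist_path uq) _.
by rewrite cardE; apply: (uniq_leq_size Uq) => x _; rewrite mem_enum.
Qed.

Lemma geodesic u v :
  exists2 p, path e u p & last u p = v /\ size p = dist e u v.
Proof. exact/dist_lt_path/dist_lt. Qed.

Lemma dist_triangle v u w : dist e u w <= dist e u v + dist e v w.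
Proof.
have [p up [lp <-]] := geodesic u v; have [q vq [<- <-]] := geodesic v w.
by rewrite -size_cat -lp -last_cat dist_path // cat_path up lp.
Qed.

Lemma dist_sym u v : dist e u v = dist e v u.
Proof.
suff H a b : dist e a b <= dist e b a by apply/eqP; rewrite eqn_leq !H.
have [p bp [lp <-]] := geodesic b a.
have := rev_path e b p; rewrite lp (eq_path (e' := e)) ?bp => [/dist_path|x y].
  by rewrite size_rev size_belast; case: p bp lp => [|c p] _ /= <- //;
     rewrite rev_cons last_rcons.
exact: sym_e.
Qed.

Lemma dist_edge u v w : e v w -> dist e u w <= (dist e u v).+1.
Proof.
move=> evw; apply: leq_trans (dist_triangle v u w) _.
by rewrite -addn1 leq_add2l (@dist_path v [:: w]) //= evw.
Qed.

(** Every vertex of a geodesic from [u] other than its end is strictly closer to [u] than that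
    end. *)
Lemma geodesic_avoids u v w :
    v != w -> dist e u v <= dist e u w ->
  exists2 p, path e u p & last u p = v /\ w \notin u :: p.
Proof.
move=> nvw led; have [p up [lp sp]] := geodesic u v.
exists p => //; split=> //; apply: contraNN nvw; rewrite in_cons => /orP[/eqP wu|].
  by move: led sp; rewrite wu dist0 leqn0 => /eqP-> /size0nil p0; rewrite -lp p0.
move=> wp; case/splitPr: wp up lp sp => p1 p2; rewrite cat_path => /andP[up1 /=].
case/andP => ew _; rewrite last_cat size_cat /= => lp sp.
have := @dist_path u (rcons p1 w); rewrite rcons_path up1 ew last_rcons size_rcons.
move/(_ isT) => lew; have := leq_trans led lew.
rewrite -sp -[leqRHS]addn1 leq_add2l ltnS leqn0 => /eqP/size0nil p20.
by rewrite -lp p20.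
Qed.

End Distance.

(** * Covers and burning sequences *)

Section Covers.
Variables (V : finType) (e : rel V) (m : nat).
Hypotheses (sym_e : symmetric e) (conn : connected e).
Hypothesis no_shorter : forall k, k < m -> ~~ has_burning_seq e k.
Implicit Types x : m.-tuple V.

Definition covers x := forall v, exists i, v \in assoc_nbhd e x i.

Definition spread_upto x j := forall i k : 'I_m,
  i < k -> k < j -> k - i <= dist e (tnth x i) (tnth x k).

(* The vertices not yet burned when the source of index j is to be lit. *)
Definition unburned x (j : nat) : pred V := fun v =>
  [forall l : 'I_m, (l < j) ==> (j - l <= dist e (tnth x l) v)].

Lemma burning_seqP x : covers x -> spread_upto x m -> burning_seq e x.
Proof.
move=> cx sx; apply/andP; split.
  by apply/eqP/setP => v; rewrite inE; have [i vi] := cx v; apply/bigcupP; exists i.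
by apply/forallP => i; apply/forallP => k; apply/implyP => /sx; apply.
Qed.

(** Otherwise the first [j] sources alone would form a burning sequence of length [j < m]. *)
Lemma ex_unburned x j : j < m -> spread_upto x j -> exists v, unburned x j v.
Proof.
move=> ltjm sx; have [/existsP//|] := boolP [exists v, unburned x j v].
rewrite negb_exists => /forallP nU.
have nb := no_shorter ltjm; suff hb : has_burning_seq e j by rewrite hb in nb.
apply/existsP.
exists [tuple tnth x (widen_ord (ltnW ltjm) i) | i < j]; apply/andP; split.
  apply/eqP/setP => v; rewrite inE; apply/bigcupP.
  have /forallPn[l] := nU v; rewrite negb_imply -ltnNge => /andP[ltlj ltd].
  exists (Ordinal ltlj) => //; rewrite inE tnth_mktuple /=.
  rewrite (_ : widen_ord _ _ = l); last exact: val_inj.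
  by rewrite -ltnS subnSK.
apply/forallP => i; apply/forallP => k; apply/implyP => ltik.
by rewrite !tnth_mktuple; apply: sx => /=.
Qed.

(** A source [j] at distance less than [j - l] from an earlier source [l] has its neighbourhood
    inside that of [l], so moving it keeps a cover. *)
Lemma replace_redundant x (j : 'I_m) b :
    covers x -> spread_upto x j -> ~~ unburned x j (tnth x j) ->
    unburned x j b ->
  exists x', [/\ covers x', spread_upto x' j.+1, tnth x' j = b &
                 forall i : 'I_m, i < j -> tnth x' i = tnth x i].
Proof.
move=> cx sx /forallPn[l]; rewrite negb_imply -ltnNge => /andP[ltlj close] /forallP Ub.
pose x' := [tuple if i == j then b else tnth x i | i < m].
have x'j : tnth x' j = b by rewrite tnth_mktuple eqxx.
have x'E i : i != j -> tnth x' i = tnth x i by rewrite tnth_mktuple => /negPf->.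
have x'lt (i : 'I_m) : i < j -> tnth x' i = tnth x i.
  by move=> lij; apply: x'E; rewrite -val_eqE /= neq_ltn lij.
exists x'; split=> // [v|i k ltik].
  have [i] := cx v; case: (eqVneq i j) => [-> | nij vi]; last first.
    by exists i; move: vi; rewrite !inE x'E.
  rewrite inE => vj; exists l; rewrite inE x'lt //.
  have := dist_triangle conn (tnth x j) (tnth x l) v; have := ltn_ord j; lia.
rewrite ltnS leq_eqVlt => /orP[/eqP/val_inj kj | ltkj].
  by rewrite kj x'j x'lt -?kj //; have := Ub i; rewrite -kj ltik.
by rewrite !x'lt ?(ltn_trans ltik) //; apply: sx.
Qed.

Lemma spread_uptoS x (j : 'I_m) :
  spread_upto x j -> unburned x j (tnth x j) -> spread_upto x j.+1.
Proof.
move=> sx /forallP Uj i k ltik; rewrite ltnS leq_eqVlt => /orP[/eqP/val_inj kj | ltkj].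
  by have := Uj i; rewrite -kj ltik.
exact: sx.
Qed.

(** Each source from index [j] on that lies in the fire is moved in turn to some unburned vertex;
    the earlier ones stay fixed. *)
Lemma complete_cover x j :
    covers x -> spread_upto x j ->
  exists2 x', burning_seq e x' & forall i : 'I_m, i < j -> tnth x' i = tnth x i.
Proof.
move En: (m - j) => n; elim: n => [|n IHn] in x j En * => cx sx.
  exists x => //; apply: burning_seqP => // i k ltik _.
  by apply: sx => //; have := ltn_ord k; lia.
have ltjm: j < m by lia.
pose jo := Ordinal ltjm; have En' : m - j.+1 = n by lia.
have [Uj | nUj] := boolP (unburned x jo (tnth x jo)).
  have [x' bx' x'E] := IHn _ _ En' cx (spread_uptoS (j := jo) sx Uj).
  by exists x' => // i ltij; apply/x'E/ltnW.
have [b Ub] := ex_unburned ltjm sx.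
have [y [cy sy _ yE]] := replace_redundant (j := jo) cx sx nUj Ub.
have [x' bx' x'E] := IHn _ _ En' cy sy.
by exists x' => // i ltij; rewrite x'E ?yE // ltnW.
Qed.

Hypothesis disj : forall x, burning_seq e x -> forall i j : 'I_m, i != j ->
  [disjoint assoc_nbhd e x i & assoc_nbhd e x j].

(* A source lit inside the fire is redundant; moving it to a vertex next to
   the fire makes its neighbourhood overlap that of an earlier source. *)
Lemma cover_burning_seq x : covers x -> burning_seq e x.
Proof.
move=> cx; apply: burning_seqP => //.
suff H j : j <= m -> spread_upto x j by apply: H.
elim: j => [|j IHj] ltjm; first by [].
have sx := IHj (ltnW ltjm); pose jo := Ordinal ltjm.
have [Uj | nUj] := boolP (unburned x jo (tnth x jo)).
  exact: (spread_uptoS (j := jo)).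
have [b0 Ub0] := ex_unburned ltjm sx.
have [l0 ltl0 _] : exists2 l : 'I_m, l < j & True.
  by have /forallPn[l] := nUj; rewrite negb_imply => /andP[ltlj _]; exists l.
have [p xp [lp _]] := geodesic conn (tnth x l0) b0.
have nU0: ~~ unburned x j (tnth x l0).
  by apply/forallPn; exists l0; rewrite ltl0 dist0 -ltnNge subn_gt0.
have := path_crossing xp nU0; rewrite lp => /(_ Ub0)[a [b [eab nUa Ub _]]].
have /forallPn[l] := nUa; rewrite negb_imply -ltnNge => /andP[ltlj ltd].
have [y [cy sy yj yE]] := replace_redundant (j := jo) cx sx nUj Ub.
have [z bz zE] := complete_cover cy sy.
have nlj: l != jo by rewrite -val_eqE /= neq_ltn ltlj.
(* [b] is the centre of neighbourhood [j], and its distance from source [l] is at most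
   [j - l <= m - l.+1]. *)
have /pred0P/(_ b) := disj bz nlj; rewrite /= !inE.
rewrite (zE jo) // yj dist0 leq0n andbT zE ?yE //=; last exact: ltnW.
have := dist_edge conn (tnth x l) eab; lia.
Qed.

End Covers.

(** * Edge cuts and leaves of a tree *)

Section Trees.
Variables (V : finType) (e : rel V).
Hypothesis treeT : is_tree e.

Let sym_e : symmetric e. Proof. by case: treeT => -[]. Qed.
Let irr_e : irreflexive e. Proof. by case: treeT => -[]. Qed.
Let conn : connected e. Proof. by case: treeT. Qed.

(** Were [a] and [b] distinct, a path between them avoiding [z] would close up through [z] to a
    cycle. *)
Lemma tree_neighbours_separated z a b p :
  e z a -> e z b -> path e a p -> last a p = b -> z \notin a :: p -> a = b.
Proof.
move=> eza ezb ap lp zp; apply/eqP/negPn/negP => nab.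
case/shortenP: ap lp => q aq Uq subq lq.
have [_ _ /(_ (z :: a :: q))] := treeT; apply.
  by case: q lq {aq Uq subq} => // /eqP; rewrite (negPf nab).
rewrite /ucycle [uniq _]/= -/(uniq (a :: q)) Uq andbT; apply/andP; split.
  by rewrite /= eza rcons_path aq lq sym_e.
apply: contra zp; rewrite !in_cons => /orP[->//|/subq->]; exact: orbT.
Qed.

Lemma leafI z : (exists a, e z a) -> (forall a b, e z a -> e z b -> a = b) -> leaf e z.
Proof.
case=> a eza uni; rewrite /leaf /degree (_ : [set _ | _] = [set a]) ?cards1 //.
apply/setP => b; rewrite !inE; apply/idP/eqP => [ezb | -> //]; exact: uni.
Qed.

Definition edge_cut (u v : V) (L : pred V) :=
  [/\ L u, ~~ L v & forall a b, e a b -> L a -> ~~ L b -> a = u /\ b = v].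

Lemma edge_cutC u v L : edge_cut u v L -> edge_cut v u (predC L).
Proof.
case=> Lu nLv cut; split=> //=; first by rewrite negbK.
by move=> a b eab nLa; rewrite negbK sym_e in eab * => Lb; have [] := cut b a eab Lb nLa.
Qed.

(** [L] is the component of [u] once the edge is removed; a path to [v] inside it would close up to
    a cycle. *)
Lemma tree_edge_cut u v : e u v -> exists L, edge_cut u v L.
Proof.
move=> euv.
pose e' := fun a b => e a b && ~~ (((a == u) && (b == v)) || ((a == v) && (b == u))).
exists (connect e' u); split.
- exact: connect0.
- apply/negP => /connectP[p up lp]; case/shortenP: up lp => q uq Uq _ lq.
  have uq' : path e u q by apply: sub_path uq => a b /andP[].
  have [_ _ /(_ (u :: q))] := treeT; apply.
    case: q lq uq {Uq uq'} => [|c [|d q]] //=.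
      by move=> vu; move: euv; rewrite vu irr_e.
    by move=> <-; rewrite /e' !eqxx andbF.
  by rewrite /ucycle Uq andbT /= rcons_path uq' -lq sym_e.
- move=> a b eab ua nub; case e'ab: (e' a b).
    by rewrite (connect_trans ua (connect1 e'ab)) in nub.
  move: e'ab; rewrite /e' eab /= => /negbT; rewrite negbK.
  case/orP=> /andP[/eqP ea /eqP eb]; first by [].
  by move: nub; rewrite eb connect0.
Qed.

(* A vertex beyond the cut that is farthest from x among those within r is at
   distance r or has no neighbour except the previous vertex on the way to x. *)
Lemma far_leaf u v L x r :
    e u v -> edge_cut u v L -> L x || (x == v) -> dist e x v <= r ->
  exists2 z, ~~ L z & dist e x z = r \/ leaf e z /\ dist e x z < r.
Proof.
move=> euv [Lu nLv cut] xside dv.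
have v_ok : ~~ L v && (dist e x v <= r) by rewrite nLv.
have [z /andP[nLz dz] maxz] := @arg_maxnP V v (fun z => ~~ L z && (dist e x z <= r))
  (dist e x) v_ok.
exists z => //; have [|ne] := eqVneq (dist e x z) r; first by left.
have ltd : dist e x z < r by rewrite ltn_neqAle ne.
(* Neighbours of [z] are still within [r], so the maximality of [z] applies to those beyond the
   cut. *)
have near a : e z a -> ~~ L a -> dist e x a <= dist e x z.
  move=> eza nLa; apply: maxz; rewrite nLa /=.
  exact: leq_trans (dist_edge conn x eza) ltd.
have neq a : e z a -> a != z by apply: contraTneq => ->; rewrite irr_e.
right; split=> //; have [zv | nzv] := eqVneq z v.
  apply: leafI => [|]; first by exists u; rewrite zv sym_e.
  suff onlyu a : e z a -> a = u by move=> a b /onlyu-> /onlyu->.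
  move=> eza; have [La | nLa] := boolP (L a).
    by rewrite sym_e zv in eza; have [] := cut a v eza La nLv.
  (* A path from [x] to a neighbour [a] of [v] beyond the cut would avoid [v], yet it has to enter
     that side at [v]. *)
  have [p xp [lp zp]] := geodesic_avoids conn (neq a eza) (near a eza nLa).
  move: zp; rewrite in_cons negb_or zv => /andP[nvx vp].
  rewrite eq_sym (negPf nvx) orbF in xside.
  have [||b [c [ebc /negPn Lb nLc cp]]] := @path_crossing _ e (predC L) x p xp.
  - by rewrite /= negbK.
  - by rewrite /= lp.
  by have [_ cv] := cut b c ebc Lb nLc; rewrite -cv cp in vp.
have inside a : e z a -> ~~ L a.
  by move=> eza; apply: contra nzv => La; rewrite sym_e in eza;
     have [_ ->] := cut a z eza La nLz.
apply: leafI => [|a b eza ezb].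
  have [[|a p] /= zp [lp _]] := geodesic conn z v; first by rewrite lp eqxx in nzv.
  by exists a; case/andP: zp.
(* Paths from [x] to [a] and to [b] that avoid [z] join to a walk from [a] to [b] avoiding [z]. *)
have [p xp [lp zp]] := geodesic_avoids conn (neq a eza) (near a eza (inside a eza)).
have [q xq [lq zq]] := geodesic_avoids conn (neq b ezb) (near b ezb (inside b ezb)).
have ap : path e a (rev (belast x p)).
  by rewrite -lp rev_path (eq_path (e' := e)).
have lap : last a (rev (belast x p)) = x.
  by case: p lp {xp zp ap} => [<- //|c p] _ /=; rewrite rev_cons last_rcons.
apply: (@tree_neighbours_separated z a b (rev (belast x p) ++ q)) => //.
- by rewrite cat_path ap lap.
- by rewrite last_cat lap.
rewrite -cat_cons mem_cat negb_or; apply/andP; split.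
  by rewrite -lp -(mem_rev (_ :: _)) rev_cons revK -lastI.
by move: zq; rewrite in_cons negb_or => /andP[].
Qed.

End Trees.

(** * Contracting the new vertex of a subdivided edge *)

Section Subdivision.
Variables (V : finType) (e : rel V) (u v : V).
Hypotheses (sym_e : symmetric e) (euv : e u v).

Definition contract (a : option V) : V := odflt u a.

(** The new vertex counts as lying on the side of [v], so that across a cut the only edge changing
    sides is the one between it and [u], which [contract] collapses. *)
Definition before_new (L : pred V) (a : option V) : bool := oapp L false a.

(* Contracting the new vertex to u loses the edge between u and the new
   vertex, which every walk from one side of it to the other uses. *)
Lemma contract_path L a p :
    edge_cut e u v L -> path (subdivide e u v) a p ->
  exists2 q, path e (contract a) q &
    last (contract a) q = contract (last a p) /\
    size q + (before_new L a != before_new L (last a p)) <= size p.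
Proof.
move=> Lcut; have [Lu nLv cut] := Lcut.
elim: p a => [|b p IHp] a /=; first by exists [::]; rewrite //= eqxx.
case/andP => sab /IHp[q bq [lq sq]].
have [sE | /eqP sN] := eqVneq (before_new L a) (before_new L b).
  have [cE | cN] := eqVneq (contract a) (contract b).
    by exists q; rewrite cE //; split=> //; rewrite sE; lia.
  exists (contract b :: q) => /=; last by split=> //; rewrite sE; lia.
  rewrite bq andbT; case: a b sab sE cN {bq lq sq} => [a|] [b|] //=.
  - by case/andP.
  - by case/orP=> /eqP-> //; rewrite ?Lu ?eqxx // sym_e.
  - by case/orP=> /eqP-> //; rewrite ?Lu ?eqxx.
suff cE : contract a = contract b.
  by exists q; rewrite cE //; split=> //; case: (_ != _) => /=; lia.
case: a b sab sN {bq lq sq} => [a|] [b|] //=.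
- case/andP => eab; case La: (L a); case Lb: (L b) => // nuv _.
    by have [au bv] := cut a b eab La (negbT Lb); rewrite au bv !eqxx in nuv.
  rewrite sym_e in eab; have [bu av] := cut b a eab Lb (negbT La).
  by rewrite bu av !eqxx orbT in nuv.
- by case/orP=> /eqP-> //; rewrite (negPf nLv).
- by case/orP=> /eqP-> //; rewrite (negPf nLv).
Qed.

Lemma contract_dist L a b :
    edge_cut e u v L -> dist (subdivide e u v) a b <= #|V| ->
  dist e (contract a) (contract b) + (before_new L a != before_new L b)
    <= dist (subdivide e u v) a b.
Proof.
move=> Lcut led; have [|p ap [<- <-]] := @dist_lt_path _ (subdivide e u v) a b.
  (* The subdivided graph has [#|V|.+1] vertices, so this distance is not the default value. *)
  by rewrite card_option.
have [q aq [lq]] := contract_path Lcut ap; apply: leq_trans.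
by rewrite leq_add2r -lq dist_path.
Qed.

End Subdivision.

Lemma burn_round_le (V : finType) (e : rel V) (m : nat) (x : m.-tuple V) (i : 'I_m) w :
  burn_round e x w <= i.+1 + dist e w (tnth x i).
Proof.
rewrite /burn_round; elim: (index_enum _) (mem_index_enum i) => //= j s IHs.
rewrite in_cons big_cons geq_min => /orP[/eqP-> | /IHs ->]; first by rewrite leqnn.
exact: orbT.
Qed.

(** * Covers of the subdivided tree *)

Section Optimal.
Variables (V : finType) (e : rel V) (m : nat).
Hypotheses (treeT : is_tree e) (bT : burning_number e = m).
Hypothesis disjT : forall x : m.-tuple V, burning_seq e x ->
  forall i j : 'I_m, i != j -> [disjoint assoc_nbhd e x i & assoc_nbhd e x j].
Hypothesis leafT : forall x : m.-tuple V, burning_seq e x ->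
  forall u : V, leaf e u -> burn_round e x u = m.

Let sym_e : symmetric e. Proof. by case: treeT => -[]. Qed.
Let conn : connected e. Proof. by case: treeT. Qed.

Let no_shorter k : k < m -> ~~ has_burning_seq e k.
Proof.
by rewrite -bT /burning_number; case: ex_minnP => n _ minn ltk;
   apply/negP => /minn; rewrite leqNgt ltk.
Qed.

Let le_m : m <= #|V|.
Proof.
rewrite -bT /burning_number; case: ex_minnP => n /existsP[x /andP[_ sx]] _.
exact: spread_out_leq sx.
Qed.

(** Contraction to [u] brings the vertices beyond the cut at least one step closer to a centre in
    [L], and those of [L] at least one step closer to a centre at the new vertex. *)
Lemma subdivide_not_covered u v L (y : m.-tuple (option V)) (i : 'I_m) :
    e u v -> edge_cut e u v L -> covers (subdivide e u v) y ->
    None \in assoc_nbhd (subdivide e u v) y i ->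
  ~~ (before_new L (tnth y i) || (tnth y i == None)).
Proof.
move=> euv Lcut cy; rewrite inE => dNone; apply/negP => iside.
have rlt (j : 'I_m) : m - j.+1 <= #|V| by apply: leq_trans le_m; apply: leq_subr.
pose x := [tuple contract u (tnth y j) | j < m].
have xE j : tnth x j = contract u (tnth y j) by rewrite tnth_mktuple.
have gain j b : dist (subdivide e u v) (tnth y j) b <= m - j.+1 ->
    dist e (tnth x j) (contract u b) + (before_new L (tnth y j) != before_new L b)
      <= m - j.+1.
  move=> led; rewrite xE; apply: leq_trans (led); apply: contract_dist => //.
  exact: leq_trans led (rlt j).
have cx : covers e x.
  move=> z; have [j] := cy (Some z); rewrite inE => /gain /= dz.
  by exists j; rewrite inE; apply: leq_trans dz; apply: leq_addr.
have bx := cover_burning_seq conn no_shorter disjT cx.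
(* At distance exactly the radius, [z] was outside neighbourhood [i] before the contraction, so
   another neighbourhood contains it; a leaf at smaller distance burns before round [m]. *)
have nogain z : before_new L (tnth y i) != L z ->
    dist e (tnth x i) z = m - i.+1 \/ leaf e z /\ dist e (tnth x i) z < m - i.+1 ->
  False.
  move=> zside [dz | [zleaf dz]]; last first.
    have := burn_round_le e x i z; rewrite leafT // (dist_sym sym_e conn).
    by have := ltn_ord i; lia.
  have [j] := cy (Some z); rewrite inE => /gain /= dj.
  have [ji | nji] := eqVneq j i.
    by move: dj; rewrite ji zside dz; lia.
  have /pred0P/(_ z) := disjT bx nji; rewrite /= !inE dz leqnn andbT.
  by move/negP; apply; apply: leq_trans dj; apply: leq_addr.
have /= dNone' := gain _ _ dNone; case/orP: iside => [Li | /eqP yi].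
  rewrite Li /= in dNone'.
  have xi : L (tnth x i) by rewrite xE; case: (tnth y i) Li.
  have [||z nLz] := @far_leaf _ e treeT u v L (tnth x i) (m - i.+1) euv Lcut.
  - by rewrite xi.
  - by apply: leq_trans (dist_edge conn _ euv) _; rewrite -addn1.
  by apply: nogain; rewrite Li (negPf nLz).
(* A centre at the new vertex contracts to [u], the first vertex beyond the cut when it is crossed
   from [v]. *)
have [||||z] := @far_leaf _ e treeT v u (predC L) (tnth x i) (m - i.+1).
- by rewrite sym_e.
- exact: edge_cutC.
- by rewrite xE yi /= eqxx orbT.
- by apply: leq_trans dNone'; apply: leq_addr.
by rewrite /= negbK => Lz; apply: nogain; rewrite yi Lz.
Qed.

End Optimal.

Lemma eq_dist (V : finType) (e e' : rel V) : e =2 e' -> dist e =2 dist e'.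
Proof.
move=> ee' a b; apply: eq_find => k; apply: eq_existsb => p.
by rewrite (eq_path ee').
Qed.

Lemma subdivideC (V : finType) (e : rel V) u v :
  subdivide e u v =2 subdivide e v u.
Proof. by case=> [a|] [b|] //=; rewrite orbC. Qed.

Lemma burnable_cover (V : finType) (e : rel V) (m : nat) (a : V) :
  burnable e m -> exists x : m.-tuple V, covers e x.
Proof.
rewrite /burnable /burning_number; case: ex_minnP => k.
case/existsP=> x /andP[/eqP cx _] _ lekm.
(* Padding with [a] may break the spreading condition, but it keeps a cover because the radii only
   grow. *)
exists [tuple nth a x i | i < m] => w.
have : w \in [set: V] by []. rewrite -cx => /bigcupP[i _].
rewrite inE (tnth_nth a) => wi; exists (widen_ord lekm i); rewrite inE tnth_mktuple /=.
by apply: leq_trans wi _; apply: leq_sub2r.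
Qed.

Theorem theorem2p3 (V : finType) (e : rel V) (m : nat)
  (treeT : is_tree e) (bT : burning_number e = m)
  (disjT : forall x : m.-tuple V, burning_seq e x ->
     forall i j : 'I_m, i != j ->
       [disjoint assoc_nbhd e x i & assoc_nbhd e x j])
  (leafT : forall x : m.-tuple V, burning_seq e x ->
     forall u : V, leaf e u -> burn_round e x u = m) :
  maximally_burnable e m.
Proof.
split=> // x p u v xp uvp /(burnable_cover None)[y cy].
have [sym_e _] : simple_graph e by case: treeT.
have euv : e u v.
  have {xp}: path e x p by case: xp => /and4P[/andP[]].
  elim: p x uvp => [|c p IHp] x //=; rewrite in_cons => /orP[/eqP[-> ->] /andP[] //|].
  by move=> uvp /andP[_]; apply: IHp.
have [L Lcut] := tree_edge_cut treeT euv.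
have [i Ni] := cy None.
have := subdivide_not_covered treeT bT disjT leafT euv Lcut cy Ni.
rewrite negb_or => /andP[nLi yi].
have evu : e v u by rewrite sym_e.
have cy' : covers (subdivide e v u) y.
  by move=> a; have [j] := cy a; rewrite inE (eq_dist (subdivideC e u v)) => aj; exists j; rewrite inE.
have Ni' : None \in assoc_nbhd (subdivide e v u) y i.
  by rewrite inE -(eq_dist (subdivideC e u v)); move: Ni; rewrite inE.
(* Exchanging [u] and [v] excludes the side of [v] as well, so no place is left for the centre. *)
have := subdivide_not_covered treeT bT disjT leafT evu (edge_cutC treeT Lcut) cy' Ni'.
by case: (tnth y i) nLi yi => //= a ->.
Qed.
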